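(* Let $M\ge 3$ and $m\ge n\ge 1$ be integers, let $H\in\mathbb{C}^{m\times n}$, $v\in\mathbb{C}^m$, and let $x^*\in\mathbb{C}^n$ be a vector each of whose entries lies in $\{e^{2\pi \mathbf{i} j/M}: j=0,1,\ldots,M-1\}$. Put $r=Hx^*+v$. If $$\lambda_{\min}(H^\dagger H)\,\sin\left(\frac{\pi}{M}\right)>\|H^\dagger v\|_\infty,$$ then both relaxations (CSDP2) and (ERSDP) are tight for problem (P).
   Context: Notation: $\mathbf{i}$ is the imaginary unit, $(\cdot)^\dagger$ is the conjugate transpose, $\mathsf{T}$ is the transpose, $\lambda_{\min}(\cdot)$ is the smallest eigenvalue, $\|u\|_\infty=\max_i|u_i|$, $A\bullet B=\mathrm{Re}(\mathrm{Trace}(A^\dagger B))$ for Hermitian (or real symmetric) $A,B$, and $A\succeq 0$ means positive semidefinite. Put $Q=H^\dagger H$ and $c=-H^\dagger r$. Problem (P) (MIMO detection): minimize $\|Hx-r\|_2^2$ over $x\in\mathbb{C}^n$ subject to $|x_i|^2=1$ and $\arg(x_i)\in\{0,2\pi/M,\ldots,2(M-1)\pi/M\}$ for $i=1,\ldots,n$. Since $\|Hx-r\|_2^2=x^\dagger Qx+2\mathrm{Re}(c^\dagger x)+\|r\|_2^2$, (P) is identified, after dropping the constant $\|r\|_2^2$, with minimizing $x^\dagger Qx+2\mathrm{Re}(c^\dagger x)$ under the same constraints; the ''optimal value of (P)'' below refers to this form without the constant. (CSDP2): let $a_j=e^{\mathbf{i}\theta_j}$ with $\theta_j=(2j-1)\pi/M$,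 $j=0,\ldots,M-1$. Minimize $Q\bullet X+2\mathrm{Re}(c^\dagger x)$ over $x\in\mathbb{C}^n$ and Hermitian $X\in\mathbb{C}^{n\times n}$ subject to $X_{i,i}=1$ for $i=1,\ldots,n$; $\mathrm{Re}(a_j^\dagger x_i)\le\cos(\pi/M)$ for $i=1,\ldots,n$, $j=0,\ldots,M-1$; and $\begin{bmatrix}1&x^\dagger\\ x&X\end{bmatrix}\succeq0$. (ERSDP): let $\hat Q=\begin{bmatrix}\mathrm{Re}(Q)&-\mathrm{Im}(Q)\\ \mathrm{Im}(Q)&\mathrm{Re}(Q)\end{bmatrix}$, $\hat c=\begin{bmatrix}\mathrm{Re}(c)\\ \mathrm{Im}(c)\end{bmatrix}$, and for $j=0,\ldots,M-1$ let $P_j=p_jp_j^{\mathsf T}$ with $p_j=(1,\cos(2j\pi/M),\sin(2j\pi/M))^{\mathsf T}$. For $y\in\mathbb{R}^{2n}$ and symmetric $Y\in\mathbb{R}^{2n\times2n}$ let $$\mathcal{Y}(i)=\begin{bmatrix}1&y_i&y_{n+i}\\ y_i&Y_{i,i}&Y_{i,n+i}\\ y_{n+i}&Y_{n+i,i}&Y_{n+i,n+i}\end{bmatrix},\quad i=1,\ldots,n.$$ Minimize $\hat Q\bullet Y+2\hat c^{\mathsf T}y$ over $y\in\mathbb{R}^{2n}$, symmetric $Y\in\mathbb{R}^{2n\times 2n}$ and $t\in\mathbb{R}^{n\times M}$ (columns indexed $0,\ldots,M-1$) subject to $\mathcal{Y}(i)=\sum_{j=0}^{M-1}t_{i,j}P_j$,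 $\sum_{j=0}^{M-1}t_{i,j}=1$ for $i=1,\ldots,n$; $t_{i,j}\ge0$ for all $i,j$; and $\begin{bmatrix}1&y^{\mathsf T}\\ y&Y\end{bmatrix}\succeq0$. Here $y$ represents the complex vector $x$ with $x_i=y_i+\mathbf{i}\,y_{n+i}$. Tightness: a semidefinite relaxation of (P) is called tight for (P) if (1) its optimal value equals the optimal value of (P) (zero gap), and (2) it recovers the true vector $x^*$ of transmitted signals; that is, for every optimal solution of the relaxation, the $x$-component (for (ERSDP), the vector $x$ with $x_i=y_i+\mathbf{i}\,y_{n+i}$) equals $x^*$. *)

(* Defs.v *)
From HB Require Import structures.
From mathcomp Require Import all_boot all_order all_algebra.
From mathcomp Require Import all_classical all_reals all_analysis.
From mathcomp Require Import complex.

Set Implicit Arguments.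
Unset Strict Implicit.
Unset Printing Implicit Defensive.

Import Order.TTheory GRing.Theory Num.Theory.
Import numFieldNormedType.Exports.

Local Open Scope classical_set_scope.
Local Open Scope ring_scope.
Local Open Scope complex_scope.
Local Open Scope sesquilinear_scope.

(* Complex numbers are R[i] for R : realType; A ^t* is the conjugate
   transpose, and complex.Re, complex.Im and Normc.normc take values in R. *)

Definition expi {R : realType} (a : R) : R[i] := cos a +i* sin a.

(* The graph of the argument function of nonzero complex numbers, with values
   in [0, 2 pi). *)
Definition is_arg {R : realType} (z : R[i]) (a : R) : Prop :=
  [/\ z != 0, 0 <= a < 2 * pi & z = (Normc.normc z)%:C * expi a].

(* The smallest eigenvalue. A Hermitian matrix of positive size has only real
   eigenvalues and at least one, and the infimum is attained: see
   lambda_minP below. *)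
Definition lambda_min {R : realType} {n : nat} (A : 'M[R[i]]_n) : R :=
  inf [set a : R | eigenvalue A a%:C].

Lemma lambda_minP {R : realType} {n : nat} (A : 'M[R[i]]_n) :
  (0 < n)%N -> A \is hermsymmx ->
  eigenvalue A (lambda_min A)%:C /\
  forall z : R[i], eigenvalue A z -> (lambda_min A)%:C <= z.
Proof.
move=> n0 hA; pose E := [set a : R | eigenvalue A a%:C].
have real_eig z : eigenvalue A z -> z = (complex.Re z)%:C.
  move=> /eigenvalueP[v vA v0].
  have AE : A = A ^t* by move/is_hermitianmxP: hA; rewrite expr0 scale1r.
  have h1 : v *m A *m v ^t* = z *: (v *m v ^t*) by rewrite vA scalemxAl.
  have h2 : v *m A *m v ^t* = z^* *: (v *m v ^t*).
    rewrite {1}AE -mulmxA.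
    have -> : A ^t* *m v ^t* = (v *m A) ^t* by rewrite trmx_mul map_mxM.
    by rewrite vA linearZ /= map_mxZ -scalemxAr.
  have vv : v *m v ^t* != 0.
    apply: contra v0 => /eqP/matrixP/(_ 0 0); rewrite !mxE => /eqP.
    rewrite psumr_eq0 => [/allP hv|j _]; last first.
      by rewrite !mxE -normCK exprn_ge0.
    apply/eqP/rowP => j; rewrite mxE; have := hv j (mem_index_enum _).
    by rewrite !mxE -normCK expf_eq0 normr_eq0 /= => /eqP.
  have zc : z = z^*.
    apply/eqP; rewrite -subr_eq0; have := h1; rewrite h2 => /eqP.
    rewrite eq_sym -subr_eq0 -scalerBl scaler_eq0 (negbTE vv) orbF.
    by [].
  case: z {vA h1 h2} zc => a b [] /= /eqP; rewrite -addr_eq0 -mulr2n.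
  by rewrite mulrn_eq0 /= => /eqP ->.
have [r rE] : exists r : seq R, forall a, E a <-> a \in r.
  have [s sE] := closed_field_poly_normal (char_poly A).
  exists [seq complex.Re z | z <- s & z == (complex.Re z)%:C] => a.
  have rs z : eigenvalue A z = (z \in s).
    rewrite eigenvalue_root_char sE rootZ ?root_prod_XsubC //.
    by rewrite lead_coef_eq0 monic_neq0 // char_poly_monic.
  rewrite /E /=; split=> [|/mapP[z]].
    by rewrite rs => ha; apply/mapP; exists a%:C; rewrite // mem_filter eqxx.
  by rewrite mem_filter => /andP[/eqP zE zs] ->; rewrite -zE rs.
have [z0 z0A] := eigenvalue_closed A n0.
have E0 : E (complex.Re z0) by rewrite /E /= -real_eig.
have [m [Em mmin]] : exists m, E m /\ forall a, E a -> m <= a.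
  have r0 := (rE _).1 E0.
  have r_gt0 : (index (complex.Re z0) r < size r)%N by rewrite index_mem.
  have [i _ hi] := @arg_minP _ R _ (Ordinal r_gt0) xpredT (fun i => r`_i) isT.
  exists r`_i; split; first exact/rE/mem_nth.
  move=> a /rE ar; have ai : (index a r < size r)%N by rewrite index_mem.
  by have := hi (Ordinal ai) isT; rewrite /= nth_index.
have -> : lambda_min A = m.
  apply/eqP; rewrite eq_le; apply/andP; split.
    by apply: ge_inf => //; exists m => a /mmin.
  by apply: lb_le_inf; [exists m | move=> a /mmin].
split=> // z zA; rewrite (real_eig _ zA) lecR; apply: mmin.
by rewrite /E /= -real_eig.
Qed.

Definition norm_inf {R : realType} {n : nat} (u : 'cV[R[i]]_n) : R :=
  \big[Num.max/0]_(i < n) Normc.normc (u i 0).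

(* In R[i], 0 <= z means that z is real and nonnegative. *)
Definition hpsd {R : realType} {n : nat} (A : 'M[R[i]]_n) : Prop :=
  A \is hermsymmx /\ forall u : 'cV[R[i]]_n, 0 <= (u ^t* *m A *m u) 0 0.

Definition spsd {R : realType} {n : nat} (A : 'M[R]_n) : Prop :=
  A \is symmetricmx /\ forall u : 'cV[R]_n, 0 <= (u^T *m A *m u) 0 0.

Definition inner_herm {R : realType} {n : nat} (A B : 'M[R[i]]_n) : R :=
  complex.Re (\tr (A ^t* *m B)).

Definition inner_sym {R : realType} {n : nat} (A B : 'M[R]_n) : R :=
  \tr (A^T *m B).

(* A minimization problem is a feasible set F and an objective f. *)
Definition optimal_value {R : realType} {T : Type} (F : set T) (f : T -> R) :
    \bar R :=
  ereal_inf [set (f z)%:E | z in F].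

Definition optimal_solution {R : realType} {T : Type} (F : set T) (f : T -> R)
    (z : T) : Prop :=
  F z /\ forall z', F z' -> f z <= f z'.

Definition P_feasible {R : realType} (n M : nat) : set 'cV[R[i]]_n :=
  [set x : 'cV[R[i]]_n | forall i, Normc.normc (x i 0) ^+ 2 = 1 /\
     exists j : 'I_M, is_arg (x i 0) (2 * j%:R * pi / M%:R)].

(* The squared residual of H x - r without the constant term, where
   Q = H ^t* *m H and c = - (H ^t* *m r). *)
Definition P_objective {R : realType} {n : nat} (Q : 'M[R[i]]_n)
    (c x : 'cV[R[i]]_n) : R :=
  complex.Re ((x ^t* *m Q *m x) 0 0) + 2 * complex.Re ((c ^t* *m x) 0 0).

Definition theta {R : realType} (M : nat) (j : 'I_M) : R :=
  (2 * j%:R - 1) * pi / M%:R.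

Definition CSDP2_feasible {R : realType} (n M : nat) :
    set ('cV[R[i]]_n * 'M[R[i]]_n) :=
  [set z : 'cV[R[i]]_n * 'M[R[i]]_n | let: (x, X) := z in
    [/\ X \is hermsymmx,
        forall i, X i i = 1,
        forall i (j : 'I_M),
          complex.Re ((expi (theta j))^* * x i 0) <= cos (pi / M%:R)
      & hpsd (block_mx 1%:M (x ^t*) x X)]].

Definition CSDP2_objective {R : realType} {n : nat} (Q : 'M[R[i]]_n)
    (c : 'cV[R[i]]_n) (z : 'cV[R[i]]_n * 'M[R[i]]_n) : R :=
  inner_herm Q z.2 + 2 * complex.Re ((c ^t* *m z.1) 0 0).

Definition realify_mx {R : realType} {n : nat} (Q : 'M[R[i]]_n) :
    'M[R]_(n + n) :=
  block_mx (map_mx (@complex.Re R) Q) (- map_mx (@complex.Im R) Q)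
           (map_mx (@complex.Im R) Q) (map_mx (@complex.Re R) Q).

Definition realify_vec {R : realType} {n : nat} (c : 'cV[R[i]]_n) :
    'cV[R]_(n + n) :=
  col_mx (map_mx (@complex.Re R) c) (map_mx (@complex.Im R) c).

Definition complexify_vec {R : realType} {n : nat} (y : 'cV[R]_(n + n)) :
    'cV[R[i]]_n :=
  \col_i (y (lshift n i) 0 +i* y (rshift n i) 0).

Definition p_vec {R : realType} (M : nat) (j : 'I_M) : 'cV[R]_3 :=
  \col_(k < 3) [:: 1; cos (2 * j%:R * pi / M%:R);
                      sin (2 * j%:R * pi / M%:R)]`_k.

Definition P_mx {R : realType} (M : nat) (j : 'I_M) : 'M[R]_3 :=
  p_vec j *m (p_vec j)^T.

Definition local_mx {R : realType} {n : nat} (y : 'cV[R]_(n + n))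
    (Y : 'M[R]_(n + n)) (i : 'I_n) : 'M[R]_3 :=
  let k := lshift n i in
  let l := rshift n i in
  \matrix_(a < 3, b < 3)
    (nth [::] [:: [:: 1;     y k 0; y l 0];
                  [:: y k 0; Y k k; Y k l];
                  [:: y l 0; Y l k; Y l l]] a)`_b.

Definition ERSDP_feasible {R : realType} (n M : nat) :
    set ('cV[R]_(n + n) * 'M[R]_(n + n) * 'M[R]_(n, M)) :=
  [set z : 'cV[R]_(n + n) * 'M[R]_(n + n) * 'M[R]_(n, M) |
    let: (y, Y, t) := z in
    [/\ Y \is symmetricmx,
        forall i, local_mx y Y i = \sum_(j < M) t i j *: P_mx j,
        forall i, \sum_(j < M) t i j = 1,
        forall i j, 0 <= t i j
      & spsd (block_mx 1%:M y^T y Y)]].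

Definition ERSDP_objective {R : realType} {n M : nat} (Q : 'M[R[i]]_n)
    (c : 'cV[R[i]]_n)
    (z : 'cV[R]_(n + n) * 'M[R]_(n + n) * 'M[R]_(n, M)) : R :=
  inner_sym (realify_mx Q) z.1.2 + 2 * ((realify_vec c)^T *m z.1.1) 0 0.

(* Tightness for (P) with data M, Q, c and transmitted vector xs, of a
   relaxation with feasible set F and objective f, where rec extracts the
   complex vector from the variable of the relaxation. *)
Definition tight {R : realType} {n : nat} (M : nat) (Q : 'M[R[i]]_n)
    (c xs : 'cV[R[i]]_n) {T : Type} (F : set T) (f : T -> R)
    (rec : T -> 'cV[R[i]]_n) : Prop :=
  optimal_value F f = optimal_value (@P_feasible R n M) (P_objective Q c) /\
  forall z, optimal_solution F f z -> rec z = xs.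

Definition CSDP2_tight {R : realType} {n : nat} (M : nat) (Q : 'M[R[i]]_n)
    (c xs : 'cV[R[i]]_n) : Prop :=
  tight M Q c xs (@CSDP2_feasible R n M) (CSDP2_objective Q c) (fun z => z.1).

Definition ERSDP_tight {R : realType} {n : nat} (M : nat) (Q : 'M[R[i]]_n)
    (c xs : 'cV[R[i]]_n) : Prop :=
  tight M Q c xs (@ERSDP_feasible R n M) (ERSDP_objective Q c)
    (fun z => complexify_vec z.1.1).

(* Main.v *)
Require Import Defs.
From HB Require Import structures.
From mathcomp Require Import all_boot all_order all_algebra.
From mathcomp Require Import all_classical all_reals all_analysis.
From mathcomp Require Import complex.
From mathcomp Require Import spectral ring lra.

Set Implicit Arguments.
Unset Strict Implicit.
Unset Printing Implicit Defensive.

Import Order.TTheory GRing.Theory Num.Theory.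
Import numFieldNormedType.Exports.

Local Open Scope ring_scope.
Local Open Scope complex_scope.
Local Open Scope sesquilinear_scope.

(** Why both relaxations are tight.

    Write A' for the conjugate transpose of A, and put w = H' v and Q = H' H,
    so that c = - (Q xs + w).  For a point (x, X) of the first relaxation let
      Z = X - x xs' - xs x' + xs xs'.
    This is the Schur-type compression of the bordered matrix
    [1, x'; x, X] by the rows [- xs, I], hence it is positive semidefinite,
    and expanding the objectives gives (lemma [CSDP2_gap])
      objective (x, X) - objective xs = Re tr (Q Z) - 2 Re (w' (x - xs)).
    The spectral theorem bounds tr (Q Z) below by lambda_min Q * tr Z
    ([lambda_min_mxtrace_le]), and since X has unit diagonal,
      tr Z = 2 sum_k (1 - Re (conj xs_k * x_k)).
    Everything is now separable in k.  Rotating xs_k to 1, the linear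
    constraints say that u = conj xs_k * x_k lies in the regular M-gon with a
    vertex at 1.  The two edges at that vertex make the angle pi/2 - pi/M with
    the inward real axis, so 1 - Re u >= sin (pi/M) * |1 - u|
    ([polygon_cone]).  Altogether
      gap >= 2 (lambda_min Q * sin (pi/M) - |w|_inf) * sum_k |x_k - xs_k|,
    and the hypothesis makes the factor positive: xs is the only possible
    x-component of a minimizer, and the value at xs is a lower bound
    ([CSDP2_unique_minimizer]).

    Feasible points x of the original problem embed as (x, x x') with the
    same objective, so xs also solves that problem.  For the second
    relaxation, the matrix W = [I, i I] sends (y, Y) to (W y, W Y W'); this
    preserves the objective and lands in the first relaxation
    ([fold_ERSDP_feasible]), because the moment condition on each block writes
    x_k as a convex combination of M-th roots of unity.  Thus the second
    relaxation is squeezed between the original problem and the first one, and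
    inherits the bound and the uniqueness. *)

(** * Real parts, moduli and conjugate transposes *)

Lemma ReD (R : realType) (z w : R[i]) :
  complex.Re (z + w) = complex.Re z + complex.Re w.
Proof. by case: z w => [a b] [c d]. Qed.

Lemma ReN (R : realType) (z : R[i]) : complex.Re (- z) = - complex.Re z.
Proof. by case: z. Qed.

Lemma Re_sum (R : realType) (I : finType) (F : I -> R[i]) :
  complex.Re (\sum_i F i) = \sum_i complex.Re (F i).
Proof. exact: (big_morph (@complex.Re R) (@ReD R) erefl). Qed.

Lemma ReM_real (R : realType) (a : R) (z : R[i]) :
  complex.Re (z * a%:C) = complex.Re z * a.
Proof. by case: z => x y /=; rewrite mulr0 subr0. Qed.

Lemma Re_conj (R : realType) (z : R[i]) :
  complex.Re (Num.conj z) = complex.Re z.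
Proof. by case: z. Qed.

Lemma Re_conjM (R : realType) (z w : R[i]) :
  complex.Re (Num.conj z * w) =
  complex.Re z * complex.Re w + complex.Im z * complex.Im w.
Proof. by case: z w => [a b] [c d] /=; rewrite mulNr opprK. Qed.

Lemma Re_mono (R : realType) (z w : R[i]) :
  z <= w -> complex.Re z <= complex.Re w.
Proof. by rewrite lecE => /andP[]. Qed.

Lemma normc_ReIm (R : realType) (z : R[i]) :
  Normc.normc z = Num.sqrt (complex.Re z ^+ 2 + complex.Im z ^+ 2).
Proof. by case: z. Qed.

Lemma normc_nonneg (R : realType) (z : R[i]) : 0 <= Normc.normc z.
Proof. by rewrite normc_ReIm sqrtr_ge0. Qed.

Lemma normc_sqr (R : realType) (z : R[i]) :
  Normc.normc z ^+ 2 = complex.Re z ^+ 2 + complex.Im z ^+ 2.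
Proof. by rewrite normc_ReIm sqr_sqrtr // addr_ge0 ?sqr_ge0. Qed.

Lemma Re_conjM_le (R : realType) (z w : R[i]) :
  complex.Re (Num.conj z * w) <= Normc.normc z * Normc.normc w.
Proof.
have -> : Normc.normc z = Normc.normc (Num.conj z).
  by rewrite !normc_ReIm; case: z => a b /=; rewrite sqrrN.
rewrite -Normc.normcM; case: (Num.conj z * w) => a b /=.
apply: le_trans (ler_norm a) _; rewrite -sqrtr_sqr ler_wsqrtr //.
by rewrite lerDl sqr_ge0.
Qed.

Lemma conj_trmxK (R : realType) m n (A : 'M[R[i]]_(m, n)) : (A ^t*) ^t* = A.
Proof. by apply/matrixP => i j; rewrite !mxE conjCK. Qed.

Lemma conj_trmx_mul (R : realType) m n p (A : 'M[R[i]]_(m, n))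
  (B : 'M[R[i]]_(n, p)) : (A *m B) ^t* = B ^t* *m A ^t*.
Proof. by rewrite trmx_mul map_mxM. Qed.

Lemma conj_trmxD (R : realType) m n (A B : 'M[R[i]]_(m, n)) :
  (A + B) ^t* = A ^t* + B ^t*.
Proof. by rewrite linearD map_mxD. Qed.

Lemma conj_trmxN (R : realType) m n (A : 'M[R[i]]_(m, n)) :
  (- A) ^t* = - A ^t*.
Proof. by rewrite linearN map_mxN. Qed.

Lemma hermsymmxE (R : realType) n (A : 'M[R[i]]_n) :
  (A \is hermsymmx) = (A == A ^t*).
Proof. by rewrite is_hermitianmxE expr0 scale1r. Qed.

Lemma gram_herm (R : realType) m n (B : 'M[R[i]]_(m, n)) :
  B ^t* *m B \is hermsymmx.
Proof. by rewrite hermsymmxE conj_trmx_mul conj_trmxK. Qed.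

(** * Positive semidefinite Hermitian matrices *)

Lemma hpsd_congr (R : realType) m n (A : 'M[R[i]]_m) (B : 'M[R[i]]_(m, n)) :
  hpsd A -> hpsd (B ^t* *m A *m B).
Proof.
case=> [+ Apos]; rewrite hermsymmxE => /eqP AE; split.
  by rewrite hermsymmxE !conj_trmx_mul -AE conj_trmxK mulmxA.
move=> u; have := Apos (B *m u).
by rewrite conj_trmx_mul !mulmxA.
Qed.

Lemma hpsd1 (R : realType) : hpsd (1%:M : 'M[R[i]]_1).
Proof.
split=> [|u]; first by rewrite hermsymmxE trmx1 map_mx1.
by rewrite mulmx1 mxE big_ord1 !mxE mulrC -normCK exprn_ge0.
Qed.

Lemma hpsd_diag_ge0 (R : realType) n (A : 'M[R[i]]_n) k :
  hpsd A -> 0 <= A k k.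
Proof.
case=> _ /(_ (delta_mx k 0)); rewrite trmx_delta map_delta_mx.
by rewrite -rowE -colE !mxE.
Qed.

(** In an orthonormal eigenbasis of Q the trace becomes a sum of eigenvalues
    weighted by the diagonal entries of Z written in that basis, and these
    weights are nonnegative. *)
Lemma lambda_min_mxtrace_le (R : realType) n (Q Z : 'M[R[i]]_n) :
  (0 < n)%N -> Q \is hermsymmx -> hpsd Z ->
  (lambda_min Q)%:C * \tr Z <= \tr (Q *m Z).
Proof.
move=> n0 hQ hZ; have [_ lam_min] := lambda_minP n0 hQ.
have /hermitian_normalmx /orthomx_spectralP := hQ.
set U := spectralmx Q; set d := spectral_diag Q.
have Uu : U \is unitarymx by exact: spectral_unitarymx.
have UU : U *m U ^t* = 1%:M by apply/unitarymxP.
have U'U : U ^t* *m U = 1%:M by apply: mulmx1C.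
rewrite invmx_unitary // => QE.
pose W := U *m Z *m U ^t*.
have hW : hpsd W by rewrite /W -{1}(conj_trmxK U); exact: hpsd_congr.
have -> : \tr Z = \tr W.
  by rewrite /W mxtrace_mulC mulmxA U'U mul1mx.
have -> : \tr (Q *m Z) = \tr (diag_mx d *m W).
  by rewrite QE /W -!mulmxA mxtrace_mulC !mulmxA.
rewrite /mxtrace mulr_sumr; apply: ler_sum => k _.
rewrite mul_diag_mx [X in _ <= X]mxE; apply: ler_wpM2r.
  exact: hpsd_diag_ge0.
apply: lam_min.
apply/eigenvalueP; exists (row k U); last first.
  apply: contraTneq (oner_neq0 R[i]) => Uk0; rewrite negbK.
  move/row_matrixP/(_ k): UU; rewrite row_mul Uk0 mul0mx => /rowP/(_ k).
  by rewrite !mxE eqxx => /esym/eqP.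
rewrite -row_mul {1}QE !mulmxA UU mul1mx.
by apply/rowP => l; rewrite mul_diag_mx !mxE.
Qed.

(** * Geometry of the regular M-gon *)

Definition psk_angle {R : realType} (M k : nat) : R := 2 * k%:R * pi / M%:R.

Lemma expiE (R : realType) (a : R) :
  (complex.Re (expi a) = cos a) * (complex.Im (expi a) = sin a).
Proof. by []. Qed.

Lemma Re_conj_expiM (R : realType) (a : R) (z : R[i]) :
  complex.Re (Num.conj (expi a) * z) =
  cos a * complex.Re z + sin a * complex.Im z.
Proof. by rewrite Re_conjM. Qed.

Lemma normc_expi (R : realType) (a : R) : Normc.normc (expi a) = 1.
Proof. by rewrite normc_ReIm !expiE cos2Dsin2 sqrtr1. Qed.

Lemma cos_le_away_from_0 (R : realType) (b x : R) :
  0 <= b -> b <= x <= 2 * pi - b -> cos x <= cos b.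
Proof.
move=> b0 /andP[bx xb]; have := @pi_gt0 R => pi0.
have mono y : b <= y <= pi -> cos y <= cos b.
  rewrite le_eqVlt => /andP[/predU1P[->//|b_y] ypi]; apply: ltW.
  rewrite ltr_cos ?in_itv /= ?ypi ?b0 ?(le_trans _ ypi) ?(ltW b_y) //.
  by rewrite (le_trans b0) ?ltW.
case: (lerP x pi) => [xpi|pix]; first by rewrite mono ?bx.
rewrite -cosN -(cosD2pi (- x)) mono // mulr2n; lra.
Qed.

Lemma theta_psk_angle (R : realType) (M : nat) (j : 'I_M) :
  theta j = psk_angle M j - pi / M%:R :> R.
Proof. by rewrite /theta /psk_angle; ring. Qed.

(** The roots of unity satisfy the edge inequalities: the angle on the left is
    an odd multiple of pi / M, and no such multiple is closer to 2 pi Z than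
    pi / M itself. *)
Lemma cos_psk_theta_le (R : realType) (M : nat) (j k : 'I_M) :
  cos (theta j - psk_angle M k) <= cos (pi / M%:R) :> R.
Proof.
have M0 : (0 < M)%N by case: (M) j => [[]|].
have M0' : (0 : R) < M%:R by rewrite ltr0n.
have piM0 : 0 < pi / M%:R :> R by rewrite divr_gt0 ?pi_gt0.
have piE : pi = M%:R * (pi / M%:R) :> R by rewrite mulrC divfK ?gt_eqF.
set b := pi / M%:R in piM0 piE *.
have dE : theta j - psk_angle M k = (2 * (j%:R - k%:R) - 1) * b.
  by rewrite /theta /psk_angle /b; ring.
have jM : (j%:R : R) + 1 <= M%:R by rewrite natr1 ler_nat ltn_ord.
have kM : (k%:R : R) + 1 <= M%:R by rewrite natr1 ler_nat ltn_ord.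
have j0 : (0 : R) <= j%:R by [].
have k0 : (0 : R) <= k%:R by [].
rewrite dE; case: (leqP j k) => [jk|kj].
  have jk' : (j%:R : R) <= k%:R by rewrite ler_nat.
  rewrite -cosN; apply: cos_le_away_from_0 (ltW piM0) _.
  by rewrite piE; apply/andP; split; nra.
have kj' : (k%:R : R) + 1 <= j%:R by rewrite natr1 ler_nat.
apply: cos_le_away_from_0 (ltW piM0) _.
by rewrite piE; apply/andP; split; nra.
Qed.

(** With (c, s) = (cos beta, sin beta), the last hypothesis describes the cone
    of half-angle pi/2 - beta around the positive real axis, on which the cosine
    of the argument is at least cos (pi/2 - beta) = s. *)
Lemma cone_bound (R : realType) (a b c s : R) :
  c ^+ 2 + s ^+ 2 = 1 -> 0 < c -> 0 <= s -> `|s * b| <= c * a ->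
  s * Num.sqrt (a ^+ 2 + b ^+ 2) <= a.
Proof.
move=> cs c0 s0 sb; have a0 : 0 <= a.
  by rewrite -(pmulr_rge0 _ c0) (le_trans _ sb).
have ab0 : 0 <= a ^+ 2 + b ^+ 2 by rewrite addr_ge0 ?sqr_ge0.
rewrite -ler_sqr ?nnegrE ?mulr_ge0 ?sqrtr_ge0 // exprMn sqr_sqrtr //.
have : (s * b) ^+ 2 <= (c * a) ^+ 2.
  by rewrite -real_normK ?num_real // ler_sqr ?nnegrE ?mulr_ge0 // ltW.
have c2 : c ^+ 2 = 1 - s ^+ 2 by rewrite -cs addrK.
by rewrite !exprMn c2; lra.
Qed.

(** Both edges at the vertex of index k occur among the constraints.  The one
    below it has index k; the one above it has index k + 1, except that for
    k = M - 1 the index wraps around to 0 and the angles differ by 2 pi, which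
    is why the lemma compares linear forms and not angles. *)
Lemma theta_above_psk_angle (R : realType) (M : nat) (k : 'I_M) :
  exists j : 'I_M, forall z : R[i],
    complex.Re (Num.conj (expi (theta j)) * z) =
    complex.Re (Num.conj (expi (psk_angle M k + pi / M%:R)) * z).
Proof.
have M0 : (0 < M)%N by case: (M) k => [[]|].
have M0' : (M%:R : R) != 0 by rewrite pnatr_eq0 -lt0n.
case: (ltnP k.+1 M) => [kM|Mk].
  exists (Ordinal kM) => z; congr (complex.Re (Num.conj (expi _) * _)).
  by rewrite /theta /psk_angle /= -natr1; ring.
have ME : M%:R = k%:R + 1 :> R.
  by rewrite natr1; congr _%:R; apply/eqP; rewrite eqn_leq Mk ltn_ord.
exists (Ordinal M0) => z.
have -> : psk_angle M k + pi / M%:R = theta (Ordinal M0) + pi *+ 2 :> R.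
  rewrite /theta /psk_angle /= mulr2n; move: M0'; rewrite ME => M0'; by field.
by rewrite !Re_conj_expiM sinD2pi cosD2pi.
Qed.

(** Only the two edges at the vertex matter: rotated so that the vertex is 1,
    they bound the polygon by the cone of [cone_bound]. *)
Lemma polygon_cone (R : realType) (M : nat) (k : 'I_M) (z : R[i]) :
  (3 <= M)%N ->
  (forall j : 'I_M,
     complex.Re (Num.conj (expi (theta j)) * z) <= cos (pi / M%:R)) ->
  sin (pi / M%:R) * Normc.normc (z - expi (psk_angle M k)) <=
  1 - complex.Re (Num.conj (expi (psk_angle M k)) * z).
Proof.
move=> M3 zpoly; have := zpoly k; have [j jE] := theta_above_psk_angle R k.
have := zpoly j; rewrite jE theta_psk_angle !Re_conj_expiM cosD cosB sinD sinB.
set al := psk_angle M k; set b := pi / M%:R.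
have b0 : 0 < b by rewrite divr_gt0 ?pi_gt0 // ltr0n (leq_trans _ M3).
have b1 : b < pi / 2.
  rewrite /b ltr_pM2l ?pi_gt0 // ltf_pV2 ?posrE ?ltr0n ?ltr_nat //.
  exact: leq_trans M3.
have c0 : 0 < cos b by apply: cos_gt0_pihalf; lra.
have s0 : 0 < sin b by apply: sin_gt0_pihalf; lra.
have csb := cos2Dsin2 b; have csa := cos2Dsin2 al.
rewrite normc_ReIm.
have [-> ->] : complex.Re (z - expi al) = complex.Re z - cos al /\
    complex.Im (z - expi al) = complex.Im z - sin al by case: (z).
move: (complex.Re z) (complex.Im z) => p q h1 h2.
(* a + i d is 1 - u for the rotated point u. *)
pose a := 1 - (cos al * p + sin al * q); pose d := sin al * p - cos al * q.
have -> : (p - cos al) ^+ 2 + (q - sin al) ^+ 2 = a ^+ 2 + d ^+ 2.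
  have -> : a ^+ 2 + d ^+ 2 = 1 - 2 * (cos al * p + sin al * q)
      + (cos al ^+ 2 + sin al ^+ 2) * (p ^+ 2 + q ^+ 2).
    by rewrite /a /d; ring.
  rewrite csa; apply: (addIr (- (cos al ^+ 2 + sin al ^+ 2))).
  by rewrite [in RHS]csa; ring.
apply: cone_bound csb c0 (ltW s0) _.
rewrite ler_norml /a /d; apply/andP; split; lra.
Qed.

(** * The optimality gap of the complex relaxation *)

Definition centered_mx {R : realType} n (xs x : 'cV[R[i]]_n) (X : 'M[R[i]]_n) :
    'M[R[i]]_n :=
  X - x *m xs ^t* - xs *m x ^t* + xs *m xs ^t*.

(** The centered matrix is the congruence of the bordered matrix by the block
    row [- xs, I]. *)
Lemma centered_mx_psd (R : realType) n (xs x : 'cV[R[i]]_n) (X : 'M[R[i]]_n) :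
  hpsd (block_mx 1%:M (x ^t*) x X) -> hpsd (centered_mx xs x X).
Proof.
move=> /(hpsd_congr (col_mx (- xs ^t*) 1%:M)).
rewrite tr_col_mx map_row_mx trmx1 map_mx1 conj_trmxN conj_trmxK.
rewrite mul_row_block mul_row_col !mul1mx !mulmx1 mulmxDl !mulNmx mulmxN.
rewrite !(opprK, mulmxN); congr (hpsd _).
rewrite /centered_mx [RHS]addrC -[LHS]addrA; congr (_ + _).
by rewrite addrA addrC addrA.
Qed.

Lemma conj_trmx_entry (R : realType) n p (A : 'M[R[i]]_(n, p)) k l :
  (A ^t*) k l = Num.conj (A l k).
Proof. by rewrite !mxE. Qed.

(** The linear coefficient is - (Q xs + w): the cross terms of the centered
    matrix absorb its Q xs part, and only the noise w remains. *)
Lemma CSDP2_gap (R : realType) n (Q X : 'M[R[i]]_n) (xs x w : 'cV[R[i]]_n) :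
  Q \is hermsymmx ->
  CSDP2_objective Q (- (Q *m xs + w)) (x, X)
    - P_objective Q (- (Q *m xs + w)) xs =
  complex.Re (\tr (Q *m centered_mx xs x X))
    - 2 * complex.Re ((w ^t* *m (x - xs)) 0 0).
Proof.
rewrite hermsymmxE => /eqP QE.
have trE (a b : 'cV[R[i]]_n) : \tr (Q *m (a *m b ^t*)) = (b ^t* *m Q *m a) 0 0.
  by rewrite mulmxA mxtrace_mulC mulmxA trace_mx11.
have symE (a b : 'cV[R[i]]_n) :
    complex.Re ((b ^t* *m Q *m a) 0 0) = complex.Re ((a ^t* *m Q *m b) 0 0).
  rewrite -Re_conj -conj_trmx_entry !conj_trmx_mul conj_trmxK -QE.
  by rewrite mulmxA.
rewrite /CSDP2_objective /P_objective /inner_herm -QE /=.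
rewrite conj_trmxN conj_trmxD conj_trmx_mul -QE.
rewrite !mulNmx !mulmxDl !mulmxBr.
have entD (A B : 'M[R[i]]_1) : (A + B) 0 0 = A 0 0 + B 0 0 by rewrite mxE.
have entN (A : 'M[R[i]]_1) : (- A) 0 0 = - A 0 0 by rewrite mxE.
rewrite /centered_mx mulmxDr !mulmxBr !mxtraceD !raddfN /= !trE.
rewrite !(entD, entN, ReD, ReN) (symE x xs).
by ring.
Qed.

Lemma le_norm_inf (R : realType) n (u : 'cV[R[i]]_n) k :
  Normc.normc (u k 0) <= norm_inf u.
Proof. by rewrite /norm_inf; apply: le_bigmax. Qed.

(** Hoelder's inequality for the pair of sup-norm and 1-norm. *)
Lemma norm_inf_dual (R : realType) n (w d : 'cV[R[i]]_n) :
  complex.Re ((w ^t* *m d) 0 0) <= norm_inf w * \sum_k Normc.normc (d k 0).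
Proof.
rewrite mxE Re_sum mulr_sumr; apply: ler_sum => k _.
rewrite conj_trmx_entry (le_trans (Re_conjM_le _ _)) //.
rewrite ler_wpM2r ?normc_nonneg //.
exact: le_norm_inf.
Qed.

Lemma centered_mx_trace (R : realType) n (xs x : 'cV[R[i]]_n) (X : 'M[R[i]]_n) :
  (forall k, Normc.normc (xs k 0) = 1) -> (forall k, X k k = 1) ->
  complex.Re (\tr (centered_mx xs x X)) =
  2 * \sum_k (1 - complex.Re (Num.conj (xs k 0) * x k 0)).
Proof.
move=> xs1 X1; rewrite /mxtrace Re_sum mulr_sumr; apply: eq_bigr => k _.
rewrite /centered_mx !mxE !big_ord1 !mxE X1 !(ReD, ReN).
have -> : complex.Re (xs k 0 * Num.conj (xs k 0)) = 1.
  by rewrite mulrC Re_conjM -!expr2 -normc_sqr xs1 expr1n.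
rewrite [x k 0 * _]mulrC [xs k 0 * _]mulrC !Re_conjM /=; ring.
Qed.

(** The gap grows at least linearly in the 1-norm of x - xs: curvature of Q,
    measured through the polygon, against the noise. *)
Lemma CSDP2_lower_bound (R : realType) (M n : nat) (Q : 'M[R[i]]_n)
    (xs w : 'cV[R[i]]_n) z :
  (3 <= M)%N -> (0 < n)%N -> Q \is hermsymmx ->
  (forall k, exists j : 'I_M, xs k 0 = expi (psk_angle M j)) ->
  0 <= lambda_min Q ->
  CSDP2_feasible M z ->
  P_objective Q (- (Q *m xs + w)) xs
    + 2 * (lambda_min Q * sin (pi / M%:R) - norm_inf w)
        * \sum_k Normc.normc ((z.1 - xs) k 0)
  <= CSDP2_objective Q (- (Q *m xs + w)) z.
Proof.
case: z => x X M3 n0 hQ xspsk lam0 [_ X1 xpoly hX]; rewrite [(x, X).1]/=.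
rewrite addrC -lerBrDr CSDP2_gap //.
have xs1 k : Normc.normc (xs k 0) = 1.
  by have [j ->] := xspsk k; rewrite normc_expi.
have := Re_mono (lambda_min_mxtrace_le n0 hQ (centered_mx_psd xs hX)).
rewrite mulrC ReM_real (centered_mx_trace _ xs1 X1) => trZ.
have wd := norm_inf_dual w (x - xs).
have cone : sin (pi / M%:R) * \sum_k Normc.normc ((x - xs) k 0) <=
    \sum_k (1 - complex.Re (Num.conj (xs k 0) * x k 0)).
  rewrite mulr_sumr; apply: ler_sum => k _; rewrite !mxE.
  by have [j ->] := xspsk k; apply: polygon_cone.
have := ler_wpM2l lam0 cone.
set S := \sum_k _ in wd *; set T := \sum_k _ in trZ *; move=> h.
nra.
Qed.

(** The slope of the lower bound is positive, so the bound is reached only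
    where the 1-norm of x - xs vanishes. *)
Lemma CSDP2_unique_minimizer (R : realType) (M n : nat) (Q : 'M[R[i]]_n)
    (xs w : 'cV[R[i]]_n) z :
  (3 <= M)%N -> (0 < n)%N -> Q \is hermsymmx ->
  (forall k, exists j : 'I_M, xs k 0 = expi (psk_angle M j)) ->
  norm_inf w < lambda_min Q * sin (pi / M%:R) ->
  CSDP2_feasible M z ->
  let c := - (Q *m xs + w) in
  P_objective Q c xs <= CSDP2_objective Q c z /\
  (CSDP2_objective Q c z <= P_objective Q c xs -> z.1 = xs).
Proof.
move=> M3 n0 hQ xspsk lamw Fz c.
have s0 : 0 < sin (pi / M%:R) :> R.
  have := @pi_gt0 R => pi0.
  rewrite sin_gt0_pi // divr_gt0 ?ltr0n ?(leq_trans _ M3) //=.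
  rewrite ltr_pdivrMr ?ltr0n ?(leq_trans _ M3) // ltr_pMr //.
  by rewrite ltr1n (leq_trans _ M3).
have w0 : 0 <= norm_inf w by rewrite /norm_inf bigmax_ge_id.
have lam0 : 0 <= lambda_min Q.
  by rewrite ltW // -(pmulr_lgt0 _ s0) (le_lt_trans w0).
have := CSDP2_lower_bound w M3 n0 hQ xspsk lam0 Fz; rewrite -/c.
set S := \sum_k _; set g := _ - norm_inf w => lb.
have g0 : 0 < g by rewrite subr_gt0.
have S0 : 0 <= S by apply: sumr_ge0 => k _; exact: normc_nonneg.
split; first by apply: le_trans lb; rewrite lerDl !mulr_ge0 // ltW.
move=> /(le_trans lb); rewrite gerDl pmulr_rle0 ?mulr_gt0 // => S0'.
have : S == 0 by rewrite eq_le S0' S0.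
rewrite psumr_eq0 => [/allP xE|k _]; last exact: normc_nonneg.
apply/colP => k; apply/eqP; rewrite -subr_eq0; apply/eqP.
have := xE k (mem_index_enum k); rewrite !mxE => /eqP; exact: Normc.eq0_normc.
Qed.

(** * Lifting, and the abstract tightness criterion *)

Lemma P_feasibleP (R : realType) (M n : nat) (x : 'cV[R[i]]_n) :
  (0 < M)%N ->
  P_feasible M x <->
  forall k, exists j : 'I_M, x k 0 = expi (psk_angle M j).
Proof.
move=> M0; split=> [Px k|xE k].
  have [/eqP + [j [_ _ ->]]] := Px k.
  rewrite sqrp_eq1 ?normc_nonneg // => /eqP ->.
  by exists j; rewrite mul1r.
have [j ->] := xE k; rewrite normc_expi expr1n; split=> //; exists j.
have M0' : (0 : R) < M%:R by rewrite ltr0n.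
split; last by rewrite normc_expi mul1r.
  apply/eqP => /(congr1 (@Normc.normc R)); rewrite normc_expi Normc.normc0.
  by move=> /eqP; rewrite oner_eq0.
have pi0 := @pi_gt0 R.
apply/andP; split; first by rewrite !(mulr_ge0, invr_ge0) // ltW.
by rewrite ltr_pdivrMr // mulrAC ltr_pM2l ?mulr_gt0 // ltr_nat.
Qed.

Lemma P_lift_CSDP2 (R : realType) (M n : nat) (x : 'cV[R[i]]_n) :
  (0 < M)%N -> P_feasible M x -> CSDP2_feasible M (x, x *m x ^t*).
Proof.
move=> M0 /(P_feasibleP _ M0) xE.
split=> [|k|k j|].
- by rewrite hermsymmxE conj_trmx_mul conj_trmxK.
- rewrite mxE big_ord1 conj_trmx_entry -normCK.
  by have [j ->] := xE k; rewrite /Num.norm /= cos2Dsin2 sqrtr1 expr1n.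
- have [l ->] := xE k; rewrite Re_conj_expiM !expiE -cosB.
  exact: cos_psk_theta_le.
- have := hpsd_congr (row_mx 1%:M (x ^t*)) (@hpsd1 R).
  rewrite mulmx1 tr_row_mx map_col_mx trmx1 map_mx1 conj_trmxK.
  by rewrite mul_col_row !mul1mx mulmx1.
Qed.

Lemma CSDP2_objective_lift (R : realType) n (Q : 'M[R[i]]_n)
    (c x : 'cV[R[i]]_n) :
  Q \is hermsymmx ->
  CSDP2_objective Q c (x, x *m x ^t*) = P_objective Q c x.
Proof.
rewrite hermsymmxE => /eqP QE.
rewrite /CSDP2_objective /P_objective /inner_herm -QE /=.
by rewrite mulmxA mxtrace_mulC mulmxA trace_mx11.
Qed.

Lemma optimal_value_attained (R : realType) (T : Type) (F : set T) (f : T -> R)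
  z : optimal_solution F f z -> optimal_value F f = (f z)%:E.
Proof.
move=> [Fz zmin]; apply/eqP; rewrite eq_le; apply/andP; split.
  by apply: ereal_inf_lbound; exists z.
by apply/ereal_infP => _ [z' Fz' <-]; rewrite lee_fin; exact: zmin.
Qed.

(** One feasible point of the relaxation attaining the value at xs, together
    with the value at xs as a lower bound that forces rec z = xs when reached,
    gives both the zero gap and the recovery. *)
Lemma tight_of_certificate (R : realType) (n M : nat) (Q : 'M[R[i]]_n)
    (c xs : 'cV[R[i]]_n) (T : Type) (F : set T) (f : T -> R)
    (rec : T -> 'cV[R[i]]_n) z0 :
  optimal_solution (@P_feasible R n M) (P_objective Q c) xs ->
  F z0 -> f z0 = P_objective Q c xs ->
  (forall z, F z -> P_objective Q c xs <= f z /\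
     (f z <= P_objective Q c xs -> rec z = xs)) ->
  tight M Q c xs F f rec.
Proof.
move=> xs_opt Fz0 fz0 lb; split.
  rewrite (optimal_value_attained xs_opt) -fz0.
  by apply: optimal_value_attained; split=> // z /lb[]; rewrite fz0.
by move=> z [Fz zmin]; apply: (lb z Fz).2; rewrite -fz0; exact: zmin.
Qed.

(** * From the real relaxation to the complex one *)

(** The identification of R^2n with C^n as a complex matrix [I, i I], so that
    complexifying a quadratic variable is a congruence. *)
Definition fold_mx {R : realType} n : 'M[R[i]]_(n, n + n) :=
  row_mx 1%:M 'i%:M.

Local Notation cplx A := (map_mx (@real_complex _) A).
Local Notation re A := (map_mx (@complex.Re _) A).

Lemma conj_trmx_cplx (R : realType) m n (A : 'M[R]_(m, n)) :
  (cplx A) ^t* = cplx (A^T).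
Proof. by apply/matrixP => i j; rewrite !mxE; apply: conjc_real. Qed.

Lemma fold_mxE (R : realType) n (y : 'cV[R]_(n + n)) :
  fold_mx n *m cplx y = complexify_vec y.
Proof.
rewrite -[y in LHS]vsubmxK map_col_mx mul_row_col mul1mx mul_scalar_mx.
by apply/colP => k; rewrite !mxE /=; apply/eqP;
    rewrite eq_complex /=; apply/andP; split; apply/eqP; ring.
Qed.

(** For u = a + i b the Hermitian form of a real symmetric matrix is the sum of
    its values at a and b; symmetry cancels the imaginary cross terms. *)
Lemma hpsd_cplx (R : realType) n (A : 'M[R]_n) : spsd A -> hpsd (cplx A).
Proof.
case=> /is_hermitianmxP; rewrite expr0 scale1r map_mx_id // => AE Apos.
split=> [|u]; first by rewrite hermsymmxE conj_trmx_cplx -AE.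
pose a := re u; pose b := map_mx (@complex.Im R) u.
have uE : u = cplx a + 'i *: cplx b.
  by apply/colP => k; rewrite !mxE; case: (u k 0) => p q; apply/eqP;
    rewrite eq_complex /=; apply/andP; split; apply/eqP; ring.
have u'E : u ^t* = cplx a^T - 'i *: cplx b^T.
  by apply/rowP => k; rewrite !mxE; case: (u k 0) => p q; apply/eqP;
    rewrite eq_complex /=; apply/andP; split; apply/eqP; ring.
have ab : (b^T *m A *m a) 0 0 = (a^T *m A *m b) 0 0.
  have -> : b^T *m A *m a = (a^T *m A *m b)^T.
    by rewrite !trmx_mul trmxK -AE mulmxA.
  by rewrite mxE.
suff -> : (u ^t* *m cplx A *m u) 0 0 =
    ((a^T *m A *m a) 0 0 + (b^T *m A *m b) 0 0)%:C.
  by rewrite ler0c addr_ge0.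
rewrite u'E uE !(mulmxDl, mulmxDr, mulNmx, =^~ scalemxAl, =^~ scalemxAr).
rewrite -!map_mxM.
move: (a^T *m A *m a) (b^T *m A *m b) (b^T *m A *m a) (a^T *m A *m b) ab.
move=> aAa bAb bAa aAb ab.
rewrite !mxE ab; apply/eqP; rewrite eq_complex /=.
by apply/andP; split; apply/eqP; ring.
Qed.

(** Taking real parts is adjoint to the embedding of real matrices, which is
    what transports the objective. *)
Lemma inner_sym_re (R : realType) n (A : 'M[R[i]]_n) (Y : 'M[R]_n) :
  complex.Re (\tr (A ^t* *m cplx Y)) = inner_sym (re A) Y.
Proof.
rewrite /inner_sym /mxtrace Re_sum; apply: eq_bigr => k _.
rewrite !mxE Re_sum; apply: eq_bigr => l _.
by rewrite !mxE ReM_real Re_conj.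
Qed.

Lemma realify_mxE (R : realType) n (Q : 'M[R[i]]_n) :
  re ((fold_mx n) ^t* *m Q *m fold_mx n) = realify_mx Q.
Proof.
rewrite /fold_mx tr_row_mx map_col_mx trmx1 map_mx1 mul_col_mx mul1mx.
rewrite mul_col_row !mulmx1 tr_scalar_mx map_scalar_mx.
rewrite !mul_scalar_mx !mul_mx_scalar.
rewrite map_block_mx /realify_mx; congr (block_mx _ _ _ _);
  apply/matrixP => k l; rewrite !mxE; case: (Q k l) => p q /=; ring.
Qed.

Lemma realify_vecE (R : realType) n (c : 'cV[R[i]]_n) :
  re ((fold_mx n) ^t* *m c) = realify_vec c.
Proof.
rewrite /fold_mx tr_row_mx map_col_mx trmx1 map_mx1 mul_col_mx mul1mx.
rewrite tr_scalar_mx map_scalar_mx mul_scalar_mx.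
rewrite map_col_mx /realify_vec; congr (col_mx _ _).
by apply/colP => k; rewrite !mxE; case: (c k 0) => p q /=; ring.
Qed.

Definition fold_ERSDP {R : realType} n M
    (z : 'cV[R]_(n + n) * 'M[R]_(n + n) * 'M[R]_(n, M)) :
    'cV[R[i]]_n * 'M[R[i]]_n :=
  (complexify_vec z.1.1, fold_mx n *m cplx z.1.2 *m (fold_mx n) ^t*).

Lemma ERSDP_objective_fold (R : realType) n M (Q : 'M[R[i]]_n)
    (c : 'cV[R[i]]_n)
    (z : 'cV[R]_(n + n) * 'M[R]_(n + n) * 'M[R]_(n, M)) :
  CSDP2_objective Q c (fold_ERSDP z) = ERSDP_objective Q c z.
Proof.
case: z => [[y Y] t]; rewrite /CSDP2_objective /ERSDP_objective /=.
congr (_ + 2 * _).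
  rewrite -realify_mxE -inner_sym_re /inner_herm !conj_trmx_mul conj_trmxK.
  by rewrite [in LHS]mulmxA mxtrace_mulC !mulmxA.
rewrite -fold_mxE -realify_vecE mulmxA !mxE Re_sum; apply: eq_bigr => k _.
rewrite [(cplx y) k 0]mxE ReM_real; congr (_ * _).
rewrite -[c ^t* *m _]conj_trmxK conj_trmx_mul conj_trmxK.
by rewrite conj_trmx_entry Re_conj !mxE.
Qed.

Lemma P_mxE (R : realType) (M : nat) (j : 'I_M) a b :
  (P_mx j : 'M[R]_3) a b = p_vec j a 0 * p_vec j b 0.
Proof. by rewrite !mxE big_ord1 !mxE. Qed.

(** The three moments that survive complexification: the two coordinates of
    x_k and its second moment, which cos^2 + sin^2 = 1 turns into the
    total weight; this is where the unit diagonal of X comes from. *)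
Lemma local_mx_moments (R : realType) n M (y : 'cV[R]_(n + n)) Y
    (t : 'M[R]_(n, M)) k :
  local_mx y Y k = \sum_(j < M) t k j *: P_mx j ->
  [/\ y (lshift n k) 0 = \sum_(j < M) t k j * cos (psk_angle M j),
      y (rshift n k) 0 = \sum_(j < M) t k j * sin (psk_angle M j)
    & Y (lshift n k) (lshift n k) + Y (rshift n k) (rshift n k) =
      \sum_(j < M) t k j].
Proof.
move=> /matrixP E.
have e (a b : 'I_3) : local_mx y Y k a b =
    \sum_(j < M) t k j * (p_vec j a 0 * p_vec j b 0).
  by rewrite E summxE; apply: eq_bigr => j _; rewrite mxE P_mxE.
have e01 := e 0 1; have e02 := e 0 (1 + 1); have e11 := e 1 1.
have e22 := e (1 + 1) (1 + 1).
rewrite !mxE /= in e01 e02 e11 e22; rewrite e01 e02 e11 e22 -big_split /=.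
split; apply: eq_bigr => j _; rewrite !mxE /= ?mul1r //.
by rewrite -mulrDr -!expr2 cos2Dsin2 mulr1.
Qed.

Lemma fold_mx_diag (R : realType) n (Y : 'M[R]_(n + n)) k :
  Y \is symmetricmx ->
  (fold_mx n *m cplx Y *m (fold_mx n) ^t*) k k =
  (Y (lshift n k) (lshift n k) + Y (rshift n k) (rshift n k))%:C.
Proof.
move=> /is_hermitianmxP; rewrite expr0 scale1r map_mx_id // => YE.
have Ysym : Y (rshift n k) (lshift n k) = Y (lshift n k) (rshift n k).
  by rewrite [in LHS]YE mxE.
rewrite -[Y in LHS]submxK map_block_mx /fold_mx tr_row_mx map_col_mx.
rewrite trmx1 map_mx1 mul_row_block mul_row_col.
rewrite !mul1mx !mulmx1 tr_scalar_mx map_scalar_mx !mul_scalar_mx mul_mx_scalar.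
rewrite !mxE Ysym; apply/eqP; rewrite eq_complex /=.
by apply/andP; split; apply/eqP; ring.
Qed.

(** The edge inequalities hold at roots of unity, hence at their convex
    combination x_k; the bordered matrix is obtained by congruence with the
    block diagonal matrix of 1 and the conjugate transpose of [I, i I]. *)
Lemma fold_ERSDP_feasible (R : realType) n M
    (z : 'cV[R]_(n + n) * 'M[R]_(n + n) * 'M[R]_(n, M)) :
  ERSDP_feasible z -> CSDP2_feasible M (fold_ERSDP z).
Proof.
case: z => [[y Y] t] [Ysym yY t1 t0 YP]; have hY := hpsd_cplx YP.
split=> [|k|k j|] /=.
- have /is_hermitianmxP := Ysym; rewrite expr0 scale1r map_mx_id // => YE.
  by rewrite hermsymmxE !conj_trmx_mul conj_trmxK conj_trmx_cplx -YE mulmxA.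
- have [_ _ m2] := local_mx_moments (yY k).
  by rewrite fold_mx_diag // m2 t1.
- have [yc ys _] := local_mx_moments (yY k).
  rewrite Re_conj_expiM mxE /= yc ys !mulr_sumr -big_split /=.
  have -> : cos (pi / M%:R) = \sum_(l < M) t k l * cos (pi / M%:R).
    by rewrite -mulr_suml t1 mul1r.
  apply: ler_sum => l _.
  rewrite mulrCA [sin _ * _]mulrCA -mulrDr -cosB ler_wpM2l //.
  exact: cos_psk_theta_le.
- have := hpsd_congr (block_mx 1%:M 0 0 ((fold_mx n) ^t*)) hY.
  rewrite map_block_mx tr_block_mx !map_block_mx.
  rewrite !trmx0 !trmx1 !map_mx0 !map_mx1.
  rewrite conj_trmxK !mulmx_block !mul0mx !mulmx0 !mul1mx !mulmx1 !addr0 !add0r.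
  by rewrite fold_mxE -conj_trmx_cplx -conj_trmx_mul fold_mxE.
Qed.

Lemma realify_vecK (R : realType) n (x : 'cV[R[i]]_n) :
  complexify_vec (realify_vec x) = x.
Proof.
apply/colP => k; rewrite mxE.
by rewrite /realify_vec col_mxEu col_mxEd !mxE; case: (x k 0).
Qed.

Lemma P_lift_ERSDP (R : realType) n M (x : 'cV[R[i]]_n) :
  (0 < M)%N -> P_feasible M x ->
  exists2 z : 'cV[R]_(n + n) * 'M[R]_(n + n) * 'M[R]_(n, M),
    ERSDP_feasible z & fold_ERSDP z = (x, x *m x ^t*).
Proof.
move=> M0 /(P_feasibleP _ M0) /boolp.choice [s sE].
pose y := realify_vec x.
exists (y, y *m y^T, \matrix_(k, j) (j == s k)%:R); last first.
  rewrite /fold_ERSDP /= realify_vecK map_mxM mulmxA fold_mxE realify_vecK.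
  by rewrite -conj_trmx_cplx -mulmxA -conj_trmx_mul fold_mxE realify_vecK.
have yl k : y (lshift n k) 0 = cos (psk_angle M (s k)).
  by rewrite /y /realify_vec col_mxEu mxE sE.
have yr k : y (rshift n k) 0 = sin (psk_angle M (s k)).
  by rewrite /y /realify_vec col_mxEd mxE sE.
split=> [|k|k|k j|].
- apply/is_hermitianmxP.
  by rewrite expr0 scale1r map_mx_id // trmx_mul trmxK.
- rewrite (bigD1 (s k)) //= big1 => [|j jk]; last first.
    by rewrite mxE (negbTE jk) scale0r.
  rewrite mxE eqxx scale1r addr0.
  clearbody y; apply/matrixP => a b; rewrite P_mxE !mxE.
  by case: a b => [[|[|[|a]]] alt] [[|[|[|b]]] blt] //=;
    rewrite ?mxE ?big_ord1 ?mxE ?yl ?yr ?mul1r ?mulr1.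
- rewrite (bigD1 (s k)) //= big1 => [|j jk]; rewrite mxE ?eqxx ?addr0 //.
  by rewrite (negbTE jk).
- by rewrite mxE.
- split=> [|u].
    apply/is_hermitianmxP; rewrite expr0 scale1r map_mx_id // tr_block_mx.
    by rewrite trmx1 trmxK trmx_mul trmxK.
  have -> : block_mx 1%:M y^T y (y *m y^T) = col_mx 1%:M y *m (col_mx 1%:M y)^T.
    by rewrite tr_col_mx trmx1 mul_col_row !mul1mx mulmx1.
  rewrite mulmxA -mulmxA; set w := col_mx _ _.
  rewrite -{1}(trmxK w) -trmx_mul.
  by rewrite mxE big_ord1 mxE -expr2 sqr_ge0.
Qed.

Theorem theorem4p4 (R : realType) (M m n : nat)
  (M_ge3 : (3 <= M)%N) (n_ge1 : (1 <= n)%N) (m_gen : (n <= m)%N)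
  (H : 'M[R[i]]_(m, n)) (v : 'cV[R[i]]_m) (xs : 'cV[R[i]]_n)
  (xs_psk : forall i, exists j : 'I_M, xs i 0 = expi (2 * pi * j%:R / M%:R))
  (hlam : lambda_min (H ^t* *m H) * sin (pi / M%:R) > norm_inf (H ^t* *m v)) :
  let r := H *m xs + v in
  let Q := H ^t* *m H in
  let c := - (H ^t* *m r) in
  CSDP2_tight M Q c xs /\ ERSDP_tight M Q c xs.
Proof.
move=> r Q c; have M0 : (0 < M)%N by apply: leq_trans M_ge3.
have hQ : Q \is hermsymmx by exact: gram_herm.
have cE : c = - (Q *m xs + H ^t* *m v) by rewrite /c /r mulmxDr mulmxA.
have xsE k : exists j : 'I_M, xs k 0 = expi (psk_angle M j).
  by have [j ->] := xs_psk k; exists j; rewrite /psk_angle (mulrAC 2).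
have Pxs : P_feasible M xs by apply/P_feasibleP.
have cert z : CSDP2_feasible M z ->
    P_objective Q c xs <= CSDP2_objective Q c z /\
    (CSDP2_objective Q c z <= P_objective Q c xs -> z.1 = xs).
  by rewrite cE; exact: CSDP2_unique_minimizer.
have xs_opt : optimal_solution (@P_feasible R n M) (P_objective Q c) xs.
  split=> // x Px; have [+ _] := cert _ (P_lift_CSDP2 M0 Px).
  by rewrite CSDP2_objective_lift.
split; rewrite /CSDP2_tight /ERSDP_tight.
  exact: (tight_of_certificate xs_opt (P_lift_CSDP2 M0 Pxs)
            (CSDP2_objective_lift c xs hQ) cert).
have [z0 Fz0 z0E] := P_lift_ERSDP M0 Pxs.
apply: (tight_of_certificate xs_opt Fz0) => [|z Fz].
  by rewrite -ERSDP_objective_fold z0E CSDP2_objective_lift.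
by rewrite -ERSDP_objective_fold; exact: cert (fold_ERSDP_feasible Fz).
Qed.
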